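(* For every (non-empty) sequent $\Gamma$, the sequent $\vdash\Gamma$ is provable in $\mathsf{LK1}$ if and only if the formula $\bigvee\Gamma$ is provable in $\mathsf{KS1}$.
   Context: Formulas: terms $t::=x\mid f(t_1,\dots,t_n)$; atoms $a::=\mathsf t\mid\mathsf f\mid p(\vec t)\mid\bar p(\vec t)$ (each predicate $p$ has a dual $\bar p$, $\bar{\bar p}=p$); formulas $A::=a\mid A\wedge A\mid A\vee A\mid\exists x.A\mid\forall x.A$ in negation normal form, with negation $\bar{\mathsf t}=\mathsf f$, $\bar{\mathsf f}=\mathsf t$, $\overline{p(\vec t)}=\bar p(\vec t)$, $\overline{\bar p(\vec t)}=p(\vec t)$, De Morgan for the rest. A sequent $\Gamma$ is a finite multiset of formulas; for $\Gamma=A_1,\dots,A_n$ ($n\geq1$) its corresponding formula is $\bigvee\Gamma=A_1\vee\dots\vee A_n$. $\mathsf{LK1}$ has rules: $\mathsf{ax}$: $\vdash a,\bar a$; $\vee$: from $\vdash\Gamma,A,B$ infer $\vdash\Gamma,A\vee B$; $\wedge$: from $\vdash\Gamma,A$ and $\vdash B,\Delta$ infer $\vdash\Gamma,A\wedge B,\Delta$; $\mathsf t$: $\vdash\mathsf t$; $\mathsf f$: from $\vdash\Gamma$ infer $\vdash\Gamma,\mathsf f$; $\mathsf{mix}$: from $\vdash\Gamma$ and $\vdash\Delta$ infer $\vdash\Gamma,\Delta$; $\exists$: from $\vdash\Gamma,A[x/t]$ infer $\vdash\Gamma,\exists x.A$; $\forall$: from $\vdash\Gamma,A$ infer $\vdash\Gamma,\forall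 x.A$ if $x$ not free in $\Gamma$; $\mathsf{ctr}$: from $\vdash\Gamma,A,A$ infer $\vdash\Gamma,A$; $\mathsf{wk}$: from $\vdash\Gamma$ infer $\vdash\Gamma,A$. $\equiv$ is the smallest congruence on formulas with $\wedge,\vee$ commutative and associative, $\forall x\forall y.A\equiv\forall y\forall x.A$, $\exists x\exists y.A\equiv\exists y\exists x.A$, $\forall x.(A\vee B)\equiv(\forall x.A)\vee B$ and $\exists x.(A\wedge B)\equiv(\exists x.A)\wedge B$ for $x$ not free in $B$. A context $S\{\ \}$ is a formula with one hole in place of an atom. $\mathsf{KS1}$ has rules (premise $\Rightarrow$ conclusion in any context $S$): $\forall$: $S\{\mathsf t\}\Rightarrow S\{\forall x.\mathsf t\}$; $\mathsf{ai}$: $S\{\mathsf t\}\Rightarrow S\{a\vee\bar a\}$; $\mathsf t$-rule: $S\{A\}\Rightarrow S\{A\wedge\mathsf t\}$; $\mathsf s$: $S\{A\wedge(B\vee C)\}\Rightarrow S\{(A\wedge B)\vee C\}$; $\mathsf{mix}$: $S\{A\wedge B\}\Rightarrow S\{A\vee B\}$; $\exists$: $S\{A[x/t]\}\Rightarrow S\{\exists x.A\}$; $\equiv$: $S\{B\}\Rightarrow S\{A\}$ if $A\equiv B$; $\mathsf w$: $S\{A\}\Rightarrow S\{A\vee B\}$; $\mathsf m$: $S\{(A\wedge C)\vee(B\wedge D)\}\Rightarrow S\{(A\vee B)\wedge(C\vee D)\}$; $\mathsf{ac}$: $S\{a\vee a\}\Rightarrow S\{a\}$; $\mathsf m_\forall$: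 $S\{(\forall x.A)\vee(\forall x.B)\}\Rightarrow S\{\forall x.(A\vee B)\}$; $\mathsf m_\exists$: same with $\exists$; $\mathsf w_\forall$: $S\{A\}\Rightarrow S\{\forall x.A\}$ ($x$ not free in $A$); $\mathsf c_\forall$: $S\{\forall x.\forall x.A\}\Rightarrow S\{\forall x.A\}$. A formula is provable in $\mathsf{KS1}$ if there is a finite sequence of formulas from $\mathsf t$ to it, each step a rule instance. *)

(* Defs.v *)
From Stdlib Require Import List Permutation Relations.
From Stdlib Require Vector.
Import ListNotations.

Set Implicit Arguments.
Unset Strict Implicit.

Record signature : Type := Signature {
  fun_symb : Type;
  fun_ar : fun_symb -> nat;
  pred_symb : Type;
  pred_ar : pred_symb -> nat
}.

(* Variables are de Bruijn indices: index 0 is bound by the innermost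
   enclosing quantifier, and free variables are the indices exceeding the
   binding depth.  Formulas are thus identified up to renaming of bound
   variables, and substitution is capture-avoiding. *)
Inductive term (Sg : signature) : Type :=
| Var (n : nat)
| Fn (f : fun_symb Sg) (ts : Vector.t (term Sg) (fun_ar f)).
Arguments Var {Sg} n.

(* [Lit true p ts] is p(ts) and [Lit false p ts] is its dual. *)
Inductive atom (Sg : signature) : Type :=
| Tt
| Ff
| Lit (b : bool) (p : pred_symb Sg) (ts : Vector.t (term Sg) (pred_ar p)).
Arguments Tt {Sg}.
Arguments Ff {Sg}.

Definition dual Sg (a : atom Sg) : atom Sg :=
  match a with
  | Tt => Ff
  | Ff => Tt
  | Lit b ts => Lit (negb b) ts
  end.

Inductive formula (Sg : signature) : Type :=
| At (a : atom Sg)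
| And (A B : formula Sg)
| Or (A B : formula Sg)
| Ex (A : formula Sg)
| All (A : formula Sg).

Fixpoint subst_term Sg (s : nat -> term Sg) (t : term Sg) : term Sg :=
  match t with
  | Var n => s n
  | Fn ts => Fn (Vector.map (subst_term s) ts)
  end.

Definition subst_atom Sg (s : nat -> term Sg) (a : atom Sg) : atom Sg :=
  match a with
  | Tt => Tt
  | Ff => Ff
  | Lit b ts => Lit b (Vector.map (subst_term s) ts)
  end.

Definition up Sg (s : nat -> term Sg) (n : nat) : term Sg :=
  match n with
  | 0 => Var 0
  | S m => subst_term (fun k => Var (S k)) (s m)
  end.

Fixpoint subst Sg (s : nat -> term Sg) (A : formula Sg) : formula Sg :=
  match A with
  | At a => At (subst_atom s a)
  | And A B => And (subst s A) (subst s B)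
  | Or A B => Or (subst s A) (subst s B)
  | Ex A => Ex (subst (up s) A)
  | All A => All (subst (up s) A)
  end.

(* [shift A] is A placed under one more binder whose variable is not free in
   it; it renders the side conditions "x not free in A". *)
Definition shift Sg (A : formula Sg) : formula Sg :=
  subst (fun n => Var (S n)) A.

(* A[x/t], where x is the variable bound by the quantifier removed from
   [Ex A]. *)
Definition inst Sg (t : term Sg) (A : formula Sg) : formula Sg :=
  subst (fun n => match n with 0 => t | S m => Var m end) A.

(* Exchanges the two innermost bound variables: forall x. forall y. A is
   [All (All A)] exactly when forall y. forall x. A is [All (All (swap A))]. *)
Definition swap Sg (A : formula Sg) : formula Sg :=
  subst (fun n => match n with 0 => Var 1 | 1 => Var 0 | _ => Var n end) A.

(* Sequents are multisets, represented by lists together with the rule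
   [LK1_perm]. *)
Definition sequent (Sg : signature) : Type := list (formula Sg).

(* The value on the empty sequent is junk. *)
Fixpoint bigor Sg (G : sequent Sg) : formula Sg :=
  match G with
  | [] => At Ff
  | [A] => A
  | A :: G' => Or A (bigor G')
  end.

Inductive LK1 (Sg : signature) : sequent Sg -> Prop :=
| LK1_perm G D : Permutation G D -> LK1 G -> LK1 D
| LK1_ax a : LK1 [At a; At (dual a)]
| LK1_or G A B : LK1 (A :: B :: G) -> LK1 (Or A B :: G)
| LK1_and G D A B : LK1 (A :: G) -> LK1 (B :: D) -> LK1 (And A B :: G ++ D)
| LK1_t : LK1 [At Tt]
| LK1_f G : LK1 G -> LK1 (At Ff :: G)
| LK1_mix G D : LK1 G -> LK1 D -> LK1 (G ++ D)
| LK1_ex G A t : LK1 (inst t A :: G) -> LK1 (Ex A :: G)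
| LK1_all G A : LK1 (A :: map (@shift Sg) G) -> LK1 (All A :: G)
| LK1_ctr G A : LK1 (A :: A :: G) -> LK1 (A :: G)
| LK1_wk G A : LK1 G -> LK1 (A :: G).

Inductive equiv (Sg : signature) : formula Sg -> formula Sg -> Prop :=
| equiv_refl A : equiv A A
| equiv_sym A B : equiv A B -> equiv B A
| equiv_trans A B C : equiv A B -> equiv B C -> equiv A C
| equiv_And A A' B B' : equiv A A' -> equiv B B' -> equiv (And A B) (And A' B')
| equiv_Or A A' B B' : equiv A A' -> equiv B B' -> equiv (Or A B) (Or A' B')
| equiv_Ex A A' : equiv A A' -> equiv (Ex A) (Ex A')
| equiv_All A A' : equiv A A' -> equiv (All A) (All A')
| equiv_andC A B : equiv (And A B) (And B A)
| equiv_andA A B C : equiv (And A (And B C)) (And (And A B) C)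
| equiv_orC A B : equiv (Or A B) (Or B A)
| equiv_orA A B C : equiv (Or A (Or B C)) (Or (Or A B) C)
| equiv_all_all A : equiv (All (All A)) (All (All (swap A)))
| equiv_ex_ex A : equiv (Ex (Ex A)) (Ex (Ex (swap A)))
| equiv_all_or A B : equiv (All (Or A (shift B))) (Or (All A) B)
| equiv_ex_and A B : equiv (Ex (And A (shift B))) (And (Ex A) B).

Inductive context (Sg : signature) : Type :=
| Hole
| CAndL (K : context Sg) (B : formula Sg)
| CAndR (A : formula Sg) (K : context Sg)
| COrL (K : context Sg) (B : formula Sg)
| COrR (A : formula Sg) (K : context Sg)
| CEx (K : context Sg)
| CAll (K : context Sg).

(* No shifting of A: quantifiers of the context above the hole capture
   variables of A. *)
Fixpoint fill Sg (K : context Sg) (A : formula Sg) : formula Sg :=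
  match K with
  | Hole _ => A
  | CAndL K B => And (fill K A) B
  | CAndR B K => And B (fill K A)
  | COrL K B => Or (fill K A) B
  | COrR B K => Or B (fill K A)
  | CEx K => Ex (fill K A)
  | CAll K => All (fill K A)
  end.

(* [KS1_rule P C]: premise P, conclusion C, before closure under contexts. *)
Inductive KS1_rule (Sg : signature) : formula Sg -> formula Sg -> Prop :=
| KS1_all : KS1_rule (At Tt) (All (At Tt))
| KS1_ai a : KS1_rule (At Tt) (Or (At a) (At (dual a)))
| KS1_t A : KS1_rule A (And A (At Tt))
| KS1_s A B C : KS1_rule (And A (Or B C)) (Or (And A B) C)
| KS1_mix A B : KS1_rule (And A B) (Or A B)
| KS1_ex A t : KS1_rule (inst t A) (Ex A)
| KS1_equiv A B : equiv A B -> KS1_rule B A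
| KS1_w A B : KS1_rule A (Or A B)
| KS1_m A B C D :
    KS1_rule (Or (And A C) (And B D)) (And (Or A B) (Or C D))
| KS1_ac a : KS1_rule (Or (At a) (At a)) (At a)
| KS1_m_all A B : KS1_rule (Or (All A) (All B)) (All (Or A B))
| KS1_m_ex A B : KS1_rule (Or (Ex A) (Ex B)) (Ex (Or A B))
| KS1_w_all A : KS1_rule A (All (shift A))
(* In forall x. forall x. A the outer quantifier binds nothing, hence the
   shift. *)
| KS1_c_all A : KS1_rule (All (shift (All A))) (All A).

Inductive KS1_step (Sg : signature) : formula Sg -> formula Sg -> Prop :=
| KS1_deep K P C : KS1_rule P C -> KS1_step (fill K P) (fill K C).

Definition KS1 Sg (A : formula Sg) : Prop :=
  clos_refl_trans _ (@KS1_step Sg) (At Tt) A.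

(* Main.v *)
(** From LK1 to KS1, each sequent rule is simulated by deep rules, a premise
    being derived from [t] inside the context where it is needed.

    From KS1 to LK1 no cut elimination is required.  Say that A entails B when
    LK1 is closed under replacing an instance of A by the same instance of B.
    Replacing, throughout a derivation, all ancestors of a chosen formula
    shows that the rules for disjunction, conjunction and universal
    quantification are invertible, and that Ex A entails B as soon as every
    instance of A does.  Hence entailment is closed under contexts and contains
    every rule of KS1. *)

From Stdlib Require Import List Permutation Relations.
From Stdlib Require Vector.
Require Import Defs.
Import ListNotations.

Set Implicit Arguments.
Unset Strict Implicit.

(** * Substitutions *)

(** The arguments of a function symbol sit in a vector, so their induction hypotheses are delivered
    as [Vector.Forall]. An inner recursion on the vector collects them. *)
Lemma term_nested_ind (Sg : signature) (P : term Sg -> Prop)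
    (HVar : forall n, P (Var n))
    (HFn : forall (f : fun_symb Sg) (ts : Vector.t (term Sg) (fun_ar f)),
        Vector.Forall P ts -> P (Fn ts)) :
  forall t, P t.
Proof.
  fix IH 1. intros [n | f ts].
  - apply HVar.
  (* The arity becomes a variable so that the recursion can descend to shorter vectors. *)
  - apply HFn. revert ts. generalize (fun_ar f).
    fix IHts 2. intros n [| t m ts]; constructor.
    + apply IH.
    + apply IHts.
Qed.

Lemma vector_map_ext_Forall (A B : Type) (f g : A -> B) n (v : Vector.t A n) :
  Vector.Forall (fun x => f x = g x) v -> Vector.map f v = Vector.map g v.
Proof. induction 1; simpl; congruence. Qed.

Lemma vector_Forall_all (A : Type) (P : A -> Prop) n (v : Vector.t A n) :
  (forall x, P x) -> Vector.Forall P v.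
Proof. intros H. induction v; constructor; auto. Qed.

Lemma subst_term_ext (Sg : signature) (s1 s2 : nat -> term Sg) t :
  (forall n, s1 n = s2 n) -> subst_term s1 t = subst_term s2 t.
Proof.
  intros E. induction t as [n | f ts IH] using term_nested_ind; simpl.
  - apply E.
  - f_equal. now apply vector_map_ext_Forall.
Qed.

Lemma subst_term_id (Sg : signature) (s : nat -> term Sg) t :
  (forall n, s n = Var n) -> subst_term s t = t.
Proof.
  intros E. induction t as [n | f ts IH] using term_nested_ind; simpl.
  - apply E.
  - f_equal. rewrite <- (Vector.map_id _ _ ts) at 2.
    now apply vector_map_ext_Forall.
Qed.

Lemma subst_term_comp (Sg : signature) (s1 s2 : nat -> term Sg) t :
  subst_term s2 (subst_term s1 t) =
  subst_term (fun n => subst_term s2 (s1 n)) t.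
Proof.
  induction t as [n | f ts IH] using term_nested_ind; simpl.
  - reflexivity.
  - f_equal. rewrite Vector.map_map. now apply vector_map_ext_Forall.
Qed.

Lemma up_ext (Sg : signature) (s1 s2 : nat -> term Sg) :
  (forall n, s1 n = s2 n) -> forall n, up s1 n = up s2 n.
Proof. intros E [|n]; simpl; now rewrite ?E. Qed.

Lemma up_id (Sg : signature) (s : nat -> term Sg) :
  (forall n, s n = Var n) -> forall n, up s n = Var n.
Proof. intros E [|n]; simpl; now rewrite ?E. Qed.

Lemma up_comp (Sg : signature) (s1 s2 : nat -> term Sg) n :
  subst_term (up s2) (up s1 n) = up (fun k => subst_term s2 (s1 k)) n.
Proof. destruct n as [|n]; simpl; now rewrite ?subst_term_comp. Qed.

Lemma subst_ext (Sg : signature) (A : formula Sg) s1 s2 :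
  (forall n, s1 n = s2 n) -> subst s1 A = subst s2 A.
Proof.
  revert s1 s2. induction A as [[| | b p ts] | | | |]; intros s1 s2 E; simpl;
    f_equal; auto using up_ext.
  f_equal. apply vector_map_ext_Forall, vector_Forall_all.
  intros t. now apply subst_term_ext.
Qed.

Lemma subst_id (Sg : signature) (A : formula Sg) s :
  (forall n, s n = Var n) -> subst s A = A.
Proof.
  revert s. induction A as [[| | b p ts] | | | |]; intros s E; simpl;
    f_equal; auto using up_id.
  f_equal. rewrite <- (Vector.map_id _ _ ts) at 2.
  apply vector_map_ext_Forall, vector_Forall_all.
  intros t. now apply subst_term_id.
Qed.

Lemma subst_comp (Sg : signature) (A : formula Sg) s1 s2 :
  subst s2 (subst s1 A) = subst (fun n => subst_term s2 (s1 n)) A.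
Proof.
  revert s1 s2. induction A as [[| | b p ts] | | | |]; intros s1 s2; simpl;
    f_equal; auto.
  - f_equal. rewrite Vector.map_map.
    apply vector_map_ext_Forall, vector_Forall_all.
    intros t. apply subst_term_comp.
  - rewrite IHA. apply subst_ext, up_comp.
  - rewrite IHA. apply subst_ext, up_comp.
Qed.

Lemma subst_Var (Sg : signature) (A : formula Sg) : subst Var A = A.
Proof. now apply subst_id. Qed.

Lemma map_subst_Var (Sg : signature) (G : sequent Sg) : map (subst Var) G = G.
Proof.
  rewrite <- (map_id G) at 2. apply map_ext. intros A. apply subst_Var.
Qed.

Lemma subst_dual (Sg : signature) (s : nat -> term Sg) a :
  subst_atom s (dual a) = dual (subst_atom s a).
Proof. now destruct a. Qed.

Ltac subst_term_eq :=
  intros; simpl; rewrite ?subst_term_comp; simpl;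
  first [ reflexivity
        | apply subst_term_id; reflexivity
        | symmetry; apply subst_term_id; reflexivity
        | apply subst_term_ext; subst_term_eq
        | apply subst_term_id; subst_term_eq
        | symmetry; apply subst_term_id; subst_term_eq ].

(** Both sides collapse to single substitutions, compared index by index. Indices 0 and 1 are split
    off because at most two binders are treated specially at a time. *)
Ltac subst_eq :=
  unfold inst, shift, swap; simpl; rewrite ?subst_comp;
  first [ apply subst_ext | apply subst_id ];
  intros [|[|?]]; subst_term_eq.

Lemma subst_inst (Sg : signature) (s : nat -> term Sg) t A :
  subst s (inst t A) = inst (subst_term s t) (subst (up s) A).
Proof. subst_eq. Qed.

Lemma subst_up_shift (Sg : signature) (s : nat -> term Sg) A :
  subst (up s) (shift A) = shift (subst s A).
Proof. subst_eq. Qed.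

Lemma map_subst_up_shift (Sg : signature) (s : nat -> term Sg) G :
  map (subst (up s)) (map (@shift Sg) G) = map (@shift Sg) (map (subst s) G).
Proof.
  rewrite !map_map. apply map_ext. intros A. apply subst_up_shift.
Qed.

Lemma inst_shift (Sg : signature) (t : term Sg) A : inst t (shift A) = A.
Proof. subst_eq. Qed.

Lemma map_inst_shift (Sg : signature) (t : term Sg) G :
  map (inst t) (map (@shift Sg) G) = G.
Proof.
  rewrite map_map. rewrite <- (map_id G) at 2. apply map_ext.
  intros A. apply inst_shift.
Qed.

(** This lets the premise with an eigenvariable be read as one particular instance of a shifted
    universal formula. *)
Lemma inst_0_up_shift (Sg : signature) (A : formula Sg) :
  inst (Var 0) (subst (up (fun n => Var (S n))) A) = A.
Proof. subst_eq. Qed.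

Lemma swap_involutive (Sg : signature) (A : formula Sg) : swap (swap A) = A.
Proof. subst_eq. Qed.

Lemma subst_up_up_swap (Sg : signature) (s : nat -> term Sg) A :
  subst (up (up s)) (swap A) = swap (subst (up (up s)) A).
Proof. subst_eq. Qed.

Lemma swap_shift_shift (Sg : signature) (A : formula Sg) :
  swap (shift (shift A)) = shift (shift A).
Proof. subst_eq. Qed.

(** * Structural properties of LK1 *)

Lemma LK1_subst (Sg : signature) (G : sequent Sg) s :
  LK1 G -> LK1 (map (subst s) G).
Proof.
  intros H. revert s.
  induction H as [G D P _ IH | a | G A B _ IH | G D A B _ IHA _ IHB | | G _ IH
                 | G D _ IHG _ IHD | G A t _ IH | G A _ IH | G A _ IH
                 | G A _ IH]; intros s; simpl.
  - exact (LK1_perm (Permutation_map (subst s) P) (IH s)).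
  - rewrite subst_dual. apply LK1_ax.
  - apply LK1_or, IH.
  - rewrite map_app. apply LK1_and; [apply IHA | apply IHB].
  - apply LK1_t.
  - apply LK1_f, IH.
  - rewrite map_app. now apply LK1_mix.
  - apply LK1_ex with (subst_term s t). rewrite <- subst_inst. apply IH.
  - apply LK1_all. rewrite <- map_subst_up_shift. apply IH.
  - apply LK1_ctr, IH.
  - apply LK1_wk, IH.
Qed.

Lemma LK1_wk_list (Sg : signature) (D G : sequent Sg) : LK1 G -> LK1 (D ++ G).
Proof. intros H. induction D; simpl; auto using LK1_wk. Qed.

Lemma LK1_wk_list_r (Sg : signature) (G D : sequent Sg) : LK1 G -> LK1 (G ++ D).
Proof.
  intros H. apply LK1_perm with (D ++ G).
  - apply Permutation_app_comm.
  - now apply LK1_wk_list.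
Qed.

Lemma LK1_ctr_list (Sg : signature) (D G : sequent Sg) :
  LK1 (D ++ D ++ G) -> LK1 (D ++ G).
Proof.
  revert G. induction D as [|A D IH]; simpl; intros G H; [exact H|].
  apply LK1_ctr.
  apply LK1_perm with (D ++ A :: A :: G).
  { rewrite <- !Permutation_middle. reflexivity. }
  apply IH. eapply LK1_perm; [|exact H].
  rewrite <- !Permutation_middle. reflexivity.
Qed.

Lemma LK1_exchange (Sg : signature) (A B : formula Sg) G :
  LK1 (A :: B :: G) -> LK1 (B :: A :: G).
Proof. apply LK1_perm, perm_swap. Qed.

(** The multiplicative rule puts two copies of [G] in the conclusion, and contraction merges
    them. *)
Lemma LK1_and_shared (Sg : signature) (A B : formula Sg) G :
  LK1 (A :: G) -> LK1 (B :: G) -> LK1 (And A B :: G).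
Proof.
  intros HA HB.
  apply LK1_perm with (G ++ [And A B]).
  { symmetry. apply Permutation_cons_append. }
  apply LK1_ctr_list. eapply LK1_perm; [|exact (LK1_and HA HB)].
  rewrite app_assoc. apply Permutation_cons_append.
Qed.

(** * Replacing the ancestors of a formula *)

(* Some instances of [X] in the first sequent become the corresponding
   instances of the sequent [D]. *)
Inductive replace (Sg : signature) (X : formula Sg) (D : sequent Sg) :
    sequent Sg -> sequent Sg -> Prop :=
| replace_nil : replace X D [] []
| replace_keep A G G' : replace X D G G' -> replace X D (A :: G) (A :: G')
| replace_inst s G G' :
    replace X D G G' ->
    replace X D (subst s X :: G) (map (subst s) D ++ G').

Lemma replace_refl (Sg : signature) (X : formula Sg) D G : replace X D G G.
Proof. induction G; now constructor. Qed.

Lemma replace_cons_inv (Sg : signature) (X : formula Sg) D A G H :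
  replace X D (A :: G) H ->
  exists C G', H = C ++ G' /\ replace X D G G' /\
    (C = [A] \/ exists s, A = subst s X /\ C = map (subst s) D).
Proof.
  inversion 1; subst.
  - exists [A], G'. auto.
  - exists (map (subst s) D), G'. eauto 7.
Qed.

Lemma replace_app_inv (Sg : signature) (X : formula Sg) D G1 G2 H :
  replace X D (G1 ++ G2) H ->
  exists H1 H2, H = H1 ++ H2 /\ replace X D G1 H1 /\ replace X D G2 H2.
Proof.
  revert H. induction G1 as [|A G1 IH]; simpl; intros H R.
  - exists [], H. split; [reflexivity|]. now split; [constructor|].
  - inversion R as [| A' G G' R' | s G G' R']; subst;
      destruct (IH _ R') as (H1 & H2 & -> & R1 & R2).
    + exists (A :: H1), H2. split; [reflexivity|]. now split; [constructor|].
    + exists (map (subst s) D ++ H1), H2.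
      rewrite app_assoc. split; [reflexivity|]. now split; [constructor|].
Qed.

(** Going up through a universal inference shifts the side formulas. A shifted instance of [X] is an
    instance under a composed substitution, which is why [replace] allows arbitrary instances. *)
Lemma replace_shift (Sg : signature) (X : formula Sg) D G H :
  replace X D G H ->
  replace X D (map (@shift Sg) G) (map (@shift Sg) H).
Proof.
  induction 1 as [| A G G' _ IH | s G G' _ IH]; simpl.
  - constructor.
  - now constructor.
  - unfold shift at 1. rewrite map_app, subst_comp.
    replace (map (@shift Sg) (map (subst s) D)) with
      (map (subst (fun n => subst_term (fun m => Var (S m)) (s n))) D).
    + now constructor.
    + rewrite map_map. apply map_ext. intros A. unfold shift.
      now rewrite subst_comp.
Qed.

(** The replacement is traced from the conclusion [G2] of an exchange back to its premise [G1]. *)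
Lemma replace_perm (Sg : signature) (X : formula Sg) D G1 G2 :
  Permutation G1 G2 -> forall H2, replace X D G2 H2 ->
  exists H1, Permutation H1 H2 /\ replace X D G1 H1.
Proof.
  induction 1 as [| A G1 G2 _ IH | A B G | G1 G2 G3 _ IH1 _ IH2];
    intros H R.
  - eauto.
  - inversion R as [| A' G G' R' | s G G' R']; subst;
      destruct (IH _ R') as (H1 & P & R1).
    + exists (A :: H1). split; [now constructor | now constructor].
    + exists (map (subst s) D ++ H1).
      split; [now apply Permutation_app_head | now constructor].
  - inversion R as [| A' G1 G1' R' | s G1 G1' R']; subst;
      inversion R' as [| A'' G2 G2' R'' | s' G2 G2' R'']; subst.
    + exists (B :: A :: G2'). split; [apply perm_swap | now do 2 constructor].
    + eexists. split; [|apply replace_inst, replace_keep, R''].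
      symmetry. apply Permutation_middle.
    + eexists. split; [|apply replace_keep, replace_inst, R''].
      apply Permutation_middle.
    + eexists. split; [|apply replace_inst, replace_inst, R''].
      apply Permutation_app_swap_app.
  - destruct (IH2 _ R) as (H2 & P2 & R2).
    destruct (IH1 _ R2) as (H1 & P1 & R1).
    exists H1. split; [now transitivity H2 | exact R1].
Qed.

(* The inferences of LK1 with an instance of [X] as principal formula remain
   admissible after the replacement of [X] by [D]. *)
Definition replaceable (Sg : signature) (X : formula Sg) (D : sequent Sg) :
    Prop :=
  match X with
  | At _ => False
  | And A B => forall s G H, LK1 (subst s A :: G) -> LK1 (subst s B :: H) ->
      LK1 (map (subst s) D ++ G ++ H)
  | Or A B => forall s G, LK1 (subst s A :: subst s B :: G) ->
      LK1 (map (subst s) D ++ G)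
  | Ex A => forall s t G, LK1 (inst t (subst (up s) A) :: G) ->
      LK1 (map (subst s) D ++ G)
  | All A => forall s G, LK1 (subst (up s) A :: map (@shift Sg) G) ->
      LK1 (map (subst s) D ++ G)
  end.

(** By induction on the derivation: an inference whose principal formula is kept is repeated, and a
    logical inference on a replaced instance of [X] is supplied by [replaceable]. *)
Lemma LK1_replace (Sg : signature) (X : formula Sg) D G G' :
  replaceable X D -> LK1 G -> replace X D G G' -> LK1 G'.
Proof.
  intros HX HG. revert G'.
  induction HG as [G H P _ IH | a | G A B _ IH | G H A B _ IHA _ IHB | | G _ IH
                 | G H _ IHG _ IHH | G A t _ IH | G A _ IH | G A _ IH
                 | G A HG IH]; intros G' R.
  - destruct (replace_perm P R) as (H1 & P1 & R1).
    exact (LK1_perm P1 (IH _ R1)).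
  - apply replace_cons_inv in R. destruct R as (C1 & G1 & -> & R & HC1).
    apply replace_cons_inv in R. destruct R as (C2 & G2 & -> & R & HC2).
    inversion R; subst.
    (* [replaceable] rules out an atomic [X], so no formula of an axiom can have been replaced. *)
    destruct X; try contradiction;
      (destruct HC1 as [-> | (s & E & _)]; [|discriminate E]);
      (destruct HC2 as [-> | (s & E & _)]; [|discriminate E]);
      apply LK1_ax.
  - apply replace_cons_inv in R. destruct R as (C & G1 & -> & R & HC).
    assert (H1 : LK1 (A :: B :: G1)) by (apply IH; now do 2 constructor).
    destruct HC as [-> | (s & E & ->)].
    + now apply LK1_or.
    + destruct X; try contradiction; try discriminate E.
      injection E as -> ->. now apply HX.
  - apply replace_cons_inv in R. destruct R as (C & G1 & -> & R & HC).
    apply replace_app_inv in R. destruct R as (G2 & H2 & -> & RG & RH).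
    assert (HA : LK1 (A :: G2)) by (apply IHA; now constructor).
    assert (HB : LK1 (B :: H2)) by (apply IHB; now constructor).
    destruct HC as [-> | (s & E & ->)].
    + exact (LK1_and HA HB).
    + destruct X; try contradiction; try discriminate E.
      injection E as -> ->. now apply HX.
  - apply replace_cons_inv in R. destruct R as (C & G1 & -> & R & HC).
    inversion R; subst.
    destruct X; try contradiction;
      (destruct HC as [-> | (s & E & _)]; [|discriminate E]); apply LK1_t.
  - apply replace_cons_inv in R. destruct R as (C & G1 & -> & R & HC).
    destruct X; try contradiction;
      (destruct HC as [-> | (s & E & _)]; [|discriminate E]);
      apply LK1_f; auto.
  - apply replace_app_inv in R. destruct R as (G2 & H2 & -> & RG & RH).
    apply LK1_mix; auto.
  - apply replace_cons_inv in R. destruct R as (C & G1 & -> & R & HC).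
    assert (H1 : LK1 (inst t A :: G1)) by (apply IH; now constructor).
    destruct HC as [-> | (s & E & ->)].
    + exact (LK1_ex H1).
    + destruct X; try contradiction; try discriminate E.
      injection E as ->. now apply HX with t.
  - apply replace_cons_inv in R. destruct R as (C & G1 & -> & R & HC).
    assert (H1 : LK1 (A :: map (@shift Sg) G1)).
    { apply IH. constructor. now apply replace_shift. }
    destruct HC as [-> | (s & E & ->)].
    + now apply LK1_all.
    + destruct X; try contradiction; try discriminate E.
      injection E as ->. now apply HX.
  - apply replace_cons_inv in R. destruct R as (C & G1 & -> & R & HC).
    (* Both copies are replaced in the same way, so the whole list [C] is contracted. *)
    apply LK1_ctr_list, IH.
    destruct HC as [-> | (s & -> & ->)]; now repeat constructor.
  - apply replace_cons_inv in R. destruct R as (C & G1 & -> & R & _).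
    apply LK1_wk_list; auto.
Qed.

Lemma LK1_replace_head (Sg : signature) (X : formula Sg) D G :
  replaceable X D -> LK1 (X :: G) -> LK1 (D ++ G).
Proof.
  intros HX HG. apply (LK1_replace HX HG).
  (* The head is the instance of [X] under the identity substitution. *)
  rewrite <- (subst_Var X) at 2. rewrite <- (map_subst_Var D) at 2.
  constructor. apply replace_refl.
Qed.

(** * Inversion of disjunction, conjunction and universal quantification *)

Lemma LK1_or_inv (Sg : signature) (A B : formula Sg) G :
  LK1 (Or A B :: G) -> LK1 (A :: B :: G).
Proof. apply (@LK1_replace_head Sg (Or A B) [A; B]). now intros s H. Qed.

(** Wherever the conjunction is introduced, the right premise is dropped and its side formulas are
    restored by weakening. *)
Lemma LK1_and_inv_l (Sg : signature) (A B : formula Sg) G :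
  LK1 (And A B :: G) -> LK1 (A :: G).
Proof.
  apply (@LK1_replace_head Sg (And A B) [A]). intros s H K HA _.
  exact (LK1_wk_list_r K HA).
Qed.

Lemma LK1_and_inv_r (Sg : signature) (A B : formula Sg) G :
  LK1 (And A B :: G) -> LK1 (B :: G).
Proof.
  apply (@LK1_replace_head Sg (And A B) [B]). intros s H K _ HB. simpl.
  apply LK1_perm with (H ++ subst s B :: K).
  { symmetry. apply Permutation_middle. }
  now apply LK1_wk_list.
Qed.

(** Where the quantifier is introduced, the term is substituted for the eigenvariable in the whole
    premise, which also undoes the shift of the side formulas. *)
Lemma LK1_all_inst (Sg : signature) (A : formula Sg) t G :
  LK1 (All A :: G) -> LK1 (inst t A :: G).
Proof.
  apply (@LK1_replace_head Sg (All A) [inst t A]). intros s H HA. simpl.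
  rewrite subst_inst, <- (map_inst_shift (subst_term s t) H).
  exact (LK1_subst _ HA).
Qed.

Lemma LK1_all_inv (Sg : signature) (A : formula Sg) G :
  LK1 (All A :: G) -> LK1 (A :: map (@shift Sg) G).
Proof.
  (* The whole sequent is shifted, which frees variable 0 to serve as the instance. *)
  intros H. rewrite <- (inst_0_up_shift A). apply LK1_all_inst.
  exact (LK1_subst _ H).
Qed.

(** * Entailment *)

(** Quantifying over [G] allows passage under connectives, and over [s] passage under quantifiers.
    Being an admissibility statement, it composes without cut. *)
Definition entails (Sg : signature) (A B : formula Sg) : Prop :=
  forall s G, LK1 (subst s A :: G) -> LK1 (subst s B :: G).

Lemma entails_refl (Sg : signature) (A : formula Sg) : entails A A.
Proof. now intros s G H. Qed.

Lemma entails_And (Sg : signature) (A A' B B' : formula Sg) :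
  entails A A' -> entails B B' -> entails (And A B) (And A' B').
Proof.
  intros HA HB s G H. simpl in *. apply LK1_and_shared.
  - apply HA. now apply LK1_and_inv_l in H.
  - apply HB. now apply LK1_and_inv_r in H.
Qed.

Lemma entails_Or (Sg : signature) (A A' B B' : formula Sg) :
  entails A A' -> entails B B' -> entails (Or A B) (Or A' B').
Proof.
  intros HA HB s G H. simpl in *.
  apply LK1_or, HA, LK1_exchange, HB, LK1_exchange, LK1_or_inv, H.
Qed.

Lemma entails_All (Sg : signature) (A A' : formula Sg) :
  entails A A' -> entails (All A) (All A').
Proof. intros HA s G H. apply LK1_all, HA, LK1_all_inv, H. Qed.

(** The existential rule is not invertible, since different ancestors may have different witnesses.
    Instead [D] is produced at each inference introducing an instance of [Ex A]; the hypothesis is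
    [replaceable] written out. *)
Lemma LK1_ex_left (Sg : signature) (A : formula Sg) D G :
  (forall s t H, LK1 (inst t (subst (up s) A) :: H) ->
                 LK1 (map (subst s) D ++ H)) ->
  LK1 (Ex A :: G) -> LK1 (D ++ G).
Proof. intros HA. now apply LK1_replace_head. Qed.

Lemma entails_Ex_left (Sg : signature) (A B : formula Sg) :
  (forall s t G, LK1 (inst t (subst (up s) A) :: G) -> LK1 (subst s B :: G)) ->
  entails (Ex A) B.
Proof.
  intros HA s G. apply (@LK1_ex_left Sg _ [subst s B]).
  intros s' t H. simpl. rewrite !subst_comp. intros HI.
  apply HA with t. eapply LK1_perm; [|exact HI].
  (* The instance met higher up results from [s] followed by [s'], and [up] commutes with this
     composition. *)
  replace (subst (fun n => subst_term (up s') (up s n)) A) with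
    (subst (up (fun n => subst_term s' (s n))) A); [reflexivity|].
  apply subst_ext. intros n. symmetry. apply up_comp.
Qed.

(** As one substitution, an instance of the body has the form to which [entails] applies. *)
Lemma inst_subst_up (Sg : signature) (s : nat -> term Sg) t A :
  inst t (subst (up s) A) =
  subst (fun n => match n with 0 => t | S m => s m end) A.
Proof. subst_eq. Qed.

Lemma entails_Ex (Sg : signature) (A A' : formula Sg) :
  entails A A' -> entails (Ex A) (Ex A').
Proof.
  intros HA. apply entails_Ex_left. intros s t G H. simpl.
  apply LK1_ex with t. rewrite inst_subst_up in *. now apply HA.
Qed.

(** * Entailments for the generators of the congruence *)

Lemma entails_all_swap (Sg : signature) (A : formula Sg) :
  entails (All (All A)) (All (All (swap A))).
Proof.
  intros s G H. simpl in *. apply LK1_all, LK1_all.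
  apply LK1_all_inv, LK1_all_inv in H.
  rewrite subst_up_up_swap.
  (* The exchange of the two eigenvariables fixes the doubly shifted side formulas, so it may act on
     the whole sequent. *)
  replace (map (@shift Sg) (map (@shift Sg) G)) with
    (map (@swap Sg) (map (@shift Sg) (map (@shift Sg) G))).
  - exact (LK1_subst _ H).
  - rewrite !map_map. apply map_ext. intros B. apply swap_shift_shift.
Qed.

Lemma entails_ex_swap (Sg : signature) (A : formula Sg) :
  entails (Ex (Ex A)) (Ex (Ex (swap A))).
Proof.
  apply entails_Ex_left. intros s t G H.
  rewrite inst_subst_up in H. revert H. simpl.
  set (r := fun n => match n with 0 => t | S m => s m end).
  apply (@LK1_ex_left Sg _ [Ex (Ex (subst (up (up s)) (swap A)))]).
  (* The witnesses are given back in the opposite order. The outer one, [t], was met first and has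
     since undergone [s']. *)
  intros s' u K H. simpl. apply LK1_ex with u. unfold inst at 1. simpl.
  apply LK1_ex with (subst_term s' t).
  eapply LK1_perm; [|exact H].
  match goal with |- Permutation (?X :: _) (?Y :: _) => replace Y with X end.
  - reflexivity.
  - subst r. subst_eq.
Qed.

Lemma entails_all_or (Sg : signature) (A B : formula Sg) :
  entails (All (Or A (shift B))) (Or (All A) B).
Proof.
  intros s G H. simpl in *. rewrite subst_up_shift in H.
  apply LK1_all_inv, LK1_or_inv in H. now apply LK1_or, LK1_all.
Qed.

Lemma entails_or_all (Sg : signature) (A B : formula Sg) :
  entails (Or (All A) B) (All (Or A (shift B))).
Proof.
  intros s G H. simpl in *. rewrite subst_up_shift.
  apply LK1_or_inv, LK1_all_inv in H. now apply LK1_all, LK1_or.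
Qed.

Lemma entails_ex_and (Sg : signature) (A B : formula Sg) :
  entails (Ex (And A (shift B))) (And (Ex A) B).
Proof.
  apply entails_Ex_left. intros s t G H. simpl in *.
  rewrite subst_up_shift in H. unfold inst in H. simpl in H.
  fold (inst t (subst (up s) A)) in H.
  fold (inst t (shift (subst s B))) in H. rewrite inst_shift in H.
  apply LK1_and_shared.
  - apply LK1_and_inv_l in H. exact (LK1_ex H).
  - now apply LK1_and_inv_r in H.
Qed.

(* The proof of [B, G] has to follow [Ex A] up to the places where [Ex A] is
   introduced, so [Ex A] is replaced by [Ex (And A B)] together with [G]. *)
Lemma entails_and_ex (Sg : signature) (A B : formula Sg) :
  entails (And (Ex A) B) (Ex (And A (shift B))).
Proof.
  intros s G H. simpl in *. rewrite subst_up_shift.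
  assert (HB := LK1_and_inv_r H). apply LK1_and_inv_l in H.
  revert HB H. generalize (subst s B) (subst (up s) A). clear s A B.
  intros B A HB H.
  set (X := Ex (And A (shift B))).
  apply LK1_perm with (G ++ [X]).
  { symmetry. apply Permutation_cons_append. }
  apply LK1_ctr_list.
  apply LK1_perm with ((X :: G) ++ G).
  { simpl. rewrite app_assoc. apply Permutation_cons_append. }
  revert H. apply LK1_ex_left. intros s t K HA. simpl.
  apply LK1_ex with t. rewrite subst_up_shift. unfold inst. simpl.
  fold (inst t (subst (up s) A)).
  fold (inst t (shift (subst s B))). rewrite inst_shift.
  (* The proof of [B, G] is carried along the substitution [s] undergone by this ancestor, so its
     side formulas form the same instance of [G]. *)
  eapply LK1_perm; [|exact (LK1_and HA (LK1_subst s HB))].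
  apply Permutation_cons; [reflexivity | apply Permutation_app_comm].
Qed.

Lemma entails_andC (Sg : signature) (A B : formula Sg) :
  entails (And A B) (And B A).
Proof.
  intros s G H. simpl in *. apply LK1_and_shared.
  - now apply LK1_and_inv_r in H.
  - now apply LK1_and_inv_l in H.
Qed.

Lemma entails_orC (Sg : signature) (A B : formula Sg) :
  entails (Or A B) (Or B A).
Proof.
  intros s G H. simpl in *. now apply LK1_or, LK1_exchange, LK1_or_inv.
Qed.

Lemma entails_andA (Sg : signature) (A B C : formula Sg) :
  entails (And A (And B C)) (And (And A B) C) /\
  entails (And (And A B) C) (And A (And B C)).
Proof.
  split; intros s G H; simpl in *;
    assert (H1 := LK1_and_inv_l H); assert (H2 := LK1_and_inv_r H);
    repeat apply LK1_and_shared; eauto using LK1_and_inv_l, LK1_and_inv_r.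
Qed.

Lemma entails_orA (Sg : signature) (A B C : formula Sg) :
  entails (Or A (Or B C)) (Or (Or A B) C) /\
  entails (Or (Or A B) C) (Or A (Or B C)).
Proof.
  split; intros s G H; simpl in *.
  - apply LK1_or_inv, LK1_exchange, LK1_or_inv in H.
    apply LK1_or, LK1_or. eapply LK1_perm; [|exact H].
    rewrite (perm_swap _ _ G), perm_swap. apply Permutation_cons; reflexivity.
  - apply LK1_or_inv, LK1_or_inv in H.
    apply LK1_or, LK1_exchange, LK1_or. eapply LK1_perm; [|exact H].
    rewrite perm_swap, (perm_swap _ _ G). reflexivity.
Qed.

(** Both directions are proved together because of the symmetry clause of [equiv]. *)
Lemma equiv_entails (Sg : signature) (A B : formula Sg) :
  equiv A B -> entails A B /\ entails B A.
Proof.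
  induction 1 as [A | A B _ [] | A B C _ [] _ [] | A A' B B' _ [] _ []
                 | A A' B B' _ [] _ [] | A A' _ [] | A A' _ []
                 | | | | | A | A | |].
  - now split.
  - now split.
  - split; intros s G HG; auto.
  - split; now apply entails_And.
  - split; now apply entails_Or.
  - split; now apply entails_Ex.
  - split; now apply entails_All.
  - split; apply entails_andC.
  - apply entails_andA.
  - split; apply entails_orC.
  - apply entails_orA.
  - split; [apply entails_all_swap|].
    (* The converse is the same entailment for [swap A]. *)
    rewrite <- (swap_involutive A) at 2. apply entails_all_swap.
  - split; [apply entails_ex_swap|].
    rewrite <- (swap_involutive A) at 2. apply entails_ex_swap.
  - split; [apply entails_all_or | apply entails_or_all].
  - split; [apply entails_ex_and | apply entails_and_ex].
Qed.

(** * Entailment for the deep rules *)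

Lemma entails_Or_l (Sg : signature) (A B : formula Sg) : entails A (Or A B).
Proof. intros s G H. apply LK1_or, LK1_exchange, LK1_wk, H. Qed.

Lemma entails_Or_r (Sg : signature) (A B : formula Sg) : entails B (Or A B).
Proof. intros s G H. apply LK1_or, LK1_wk, H. Qed.

(** Inversion followed by contraction makes disjunction a least upper bound; atomic contraction and
    the quantifier medials follow from this. *)
Lemma entails_Or_elim (Sg : signature) (A B C : formula Sg) :
  entails A C -> entails B C -> entails (Or A B) C.
Proof.
  intros HA HB s G H.
  apply LK1_ctr, HA, LK1_exchange, HB, LK1_exchange, LK1_or_inv, H.
Qed.

Lemma KS1_rule_entails (Sg : signature) (P C : formula Sg) :
  KS1_rule P C -> entails P C.
Proof.
  intros [| a | A | A B C1 | A B | A t | A B E | A B | A B C1 D | a | A B | A B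
         | A | A].
  - intros s G _. apply LK1_all, (LK1_wk_list_r _ (LK1_t Sg)).
  - intros s G _. simpl. rewrite subst_dual.
    apply LK1_or, (LK1_wk_list_r G (LK1_ax (subst_atom s a))).
  - intros s G H. apply LK1_and_shared; [exact H|].
    apply (LK1_wk_list_r _ (LK1_t Sg)).
  - intros s G H. simpl in *. apply LK1_or, LK1_and_shared.
    + apply LK1_exchange, LK1_wk. now apply LK1_and_inv_l in H.
    + now apply LK1_and_inv_r, LK1_or_inv in H.
  - intros s G H. apply LK1_and_inv_l in H. now apply entails_Or_l.
  - intros s G H. simpl. apply LK1_ex with (subst_term s t).
    now rewrite <- subst_inst.
  - now apply equiv_entails in E.
  - apply entails_Or_l.
  (* In the medial rule, the left conjuncts of the two disjuncts give one half of the conclusion and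
     the right conjuncts the other. *)
  - intros s G H. simpl in *. apply LK1_or_inv in H. apply LK1_and_shared.
    + apply LK1_or, LK1_exchange. apply LK1_and_inv_l, LK1_exchange in H.
      now apply LK1_and_inv_l in H.
    + apply LK1_or, LK1_exchange. apply LK1_and_inv_r, LK1_exchange in H.
      now apply LK1_and_inv_r in H.
  - apply entails_Or_elim; apply entails_refl.
  - apply entails_Or_elim; apply entails_All; [apply entails_Or_l|].
    apply entails_Or_r.
  - apply entails_Or_elim; apply entails_Ex; [apply entails_Or_l|].
    apply entails_Or_r.
  - intros s G H. simpl. rewrite subst_up_shift.
    apply LK1_all. exact (LK1_subst _ H).
  - intros s G H.
    change (LK1 (All (subst (up s) (shift (All A))) :: G)) in H.
    rewrite subst_up_shift in H.
    (* The outer quantifier is vacuous, so an arbitrary instance removes it. *)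
    apply LK1_all_inst with (t := Var 0) in H. now rewrite inst_shift in H.
Qed.

Lemma KS1_step_entails (Sg : signature) (A B : formula Sg) :
  KS1_step A B -> entails A B.
Proof.
  intros [K P C HR]. apply KS1_rule_entails in HR.
  induction K; simpl;
    auto using entails_And, entails_Or, entails_Ex, entails_All, entails_refl.
Qed.

Lemma KS1_LK1 (Sg : signature) (A : formula Sg) : KS1 A -> LK1 [A].
Proof.
  (* Steps are peeled off at the end, so the induction hypothesis proves the formula just before the
     last step. *)
  intros H. apply clos_rt_rtn1 in H.
  induction H as [| A B HS _ IH].
  - apply LK1_t.
  - apply KS1_step_entails in HS. rewrite <- (subst_Var B). apply HS.
    now rewrite subst_Var.
Qed.

Lemma LK1_bigor_inv (Sg : signature) (G : sequent Sg) :
  G <> [] -> LK1 [bigor G] -> LK1 G.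
Proof.
  intros HG H. cut (LK1 (G ++ [])); [now rewrite app_nil_r|].
  (* An arbitrary side context is needed to hold the disjuncts already split off. *)
  revert HG H. generalize (@nil (formula Sg)) at 2 3.
  induction G as [|A [|B G] IH]; intros D HG H.
  - contradiction.
  - exact H.
  - change (LK1 (Or A (bigor (B :: G)) :: D)) in H. apply LK1_or_inv in H.
    apply LK1_perm with ((B :: G) ++ A :: D).
    { symmetry. apply Permutation_middle. }
    apply IH; [discriminate|]. now apply LK1_exchange.
Qed.

(** * Deep derivations *)

Definition derives (Sg : signature) : formula Sg -> formula Sg -> Prop :=
  clos_refl_trans _ (@KS1_step Sg).

Lemma derives_trans (Sg : signature) (B A C : formula Sg) :
  derives A B -> derives B C -> derives A C.
Proof. apply rt_trans. Qed.

Lemma derives_rule (Sg : signature) (P C : formula Sg) :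
  KS1_rule P C -> derives P C.
Proof. intros H. apply rt_step. exact (KS1_deep (Hole Sg) H). Qed.

Lemma derives_equiv (Sg : signature) (A B : formula Sg) :
  equiv A B -> derives A B.
Proof. intros H. now apply derives_rule, KS1_equiv, equiv_sym. Qed.

Fixpoint context_comp (Sg : signature) (K L : context Sg) : context Sg :=
  match K with
  | Hole _ => L
  | CAndL K B => CAndL (context_comp K L) B
  | CAndR A K => CAndR A (context_comp K L)
  | COrL K B => COrL (context_comp K L) B
  | COrR A K => COrR A (context_comp K L)
  | CEx K => CEx (context_comp K L)
  | CAll K => CAll (context_comp K L)
  end.

Lemma fill_context_comp (Sg : signature) (K L : context Sg) A :
  fill (context_comp K L) A = fill K (fill L A).
Proof. induction K; simpl; congruence. Qed.

Lemma derives_fill (Sg : signature) (K : context Sg) A B :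
  derives A B -> derives (fill K A) (fill K B).
Proof.
  induction 1 as [A B [L P C HR] | A | A B C _ IH1 _ IH2].
  - apply rt_step. rewrite <- !fill_context_comp. now apply KS1_deep.
  - apply rt_refl.
  - exact (derives_trans IH1 IH2).
Qed.

Lemma derives_And (Sg : signature) (A A' B B' : formula Sg) :
  derives A A' -> derives B B' -> derives (And A B) (And A' B').
Proof.
  intros HA HB. apply derives_trans with (And A' B).
  - exact (derives_fill (CAndL (Hole Sg) B) HA).
  - exact (derives_fill (CAndR A' (Hole Sg)) HB).
Qed.

Lemma derives_Or (Sg : signature) (A A' B B' : formula Sg) :
  derives A A' -> derives B B' -> derives (Or A B) (Or A' B').
Proof.
  intros HA HB. apply derives_trans with (Or A' B).
  - exact (derives_fill (COrL (Hole Sg) B) HA).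
  - exact (derives_fill (COrR A' (Hole Sg)) HB).
Qed.

Lemma derives_All (Sg : signature) (A A' : formula Sg) :
  derives A A' -> derives (All A) (All A').
Proof. exact (@derives_fill Sg (CAll (Hole Sg)) A A'). Qed.

Lemma derives_Ex (Sg : signature) (A A' : formula Sg) :
  derives A A' -> derives (Ex A) (Ex A').
Proof. exact (@derives_fill Sg (CEx (Hole Sg)) A A'). Qed.

Lemma equiv_or_interchange (Sg : signature) (A B C D : formula Sg) :
  equiv (Or (Or A B) (Or C D)) (Or (Or A C) (Or B D)).
Proof.
  apply equiv_trans with (Or A (Or B (Or C D))).
  { apply equiv_sym, equiv_orA. }
  apply equiv_trans with (Or A (Or C (Or B D))); [|apply equiv_orA].
  apply equiv_Or; [apply equiv_refl|].
  apply equiv_trans with (Or (Or B C) D); [apply equiv_orA|].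
  apply equiv_trans with (Or (Or C B) D); [|apply equiv_sym, equiv_orA].
  apply equiv_Or; [apply equiv_orC | apply equiv_refl].
Qed.

(** Contraction is reduced to atoms: medial rules move it through conjunction and the quantifiers,
    and rearranging disjuncts suffices for disjunction. *)
Lemma derives_contraction (Sg : signature) (A : formula Sg) :
  derives (Or A A) A.
Proof.
  induction A as [a | A IHA B IHB | A IHA B IHB | A IH | A IH].
  - apply derives_rule, KS1_ac.
  - eapply derives_trans; [apply derives_rule, KS1_m|]. now apply derives_And.
  - eapply derives_trans; [apply derives_equiv, equiv_or_interchange|].
    now apply derives_Or.
  - eapply derives_trans; [apply derives_rule, KS1_m_ex|]. now apply derives_Ex.
  - eapply derives_trans; [apply derives_rule, KS1_m_all|].
    now apply derives_All.
Qed.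

(** * Disjunctions of sequents and the simulation of the sequent rules *)

Lemma bigor_cons (Sg : signature) (A : formula Sg) G :
  G <> [] -> bigor (A :: G) = Or A (bigor G).
Proof. now destruct G. Qed.

Lemma bigor_cons_cons (Sg : signature) (A B : formula Sg) G :
  bigor (A :: B :: G) = Or A (bigor (B :: G)).
Proof. reflexivity. Qed.

(** An empty side would add the disjunct [At Ff], which the congruence cannot absorb. *)
Lemma bigor_app (Sg : signature) (G D : sequent Sg) :
  G <> [] -> D <> [] -> equiv (Or (bigor G) (bigor D)) (bigor (G ++ D)).
Proof.
  intros HG HD. induction G as [|A [|B G] IH]; [contradiction| |].
  - simpl app. rewrite (bigor_cons A HD). apply equiv_refl.
  - change ((A :: B :: G) ++ D) with (A :: (B :: G) ++ D).
    rewrite !bigor_cons_cons.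
    eapply equiv_trans; [apply equiv_sym, equiv_orA|].
    apply equiv_Or; [apply equiv_refl|]. now apply IH.
Qed.

Lemma bigor_perm (Sg : signature) (G D : sequent Sg) :
  Permutation G D -> equiv (bigor G) (bigor D).
Proof.
  induction 1 as [| A G D P IH | A B G | G D E _ IH1 _ IH2].
  - apply equiv_refl.
  - destruct G as [|B G].
    + apply Permutation_nil in P. subst. apply equiv_refl.
    + assert (HD : D <> []).
      { intros ->. now apply Permutation_sym, Permutation_nil in P. }
      rewrite (bigor_cons A HD), bigor_cons_cons.
      apply equiv_Or; [apply equiv_refl | exact IH].
  - destruct G as [|C G]; [apply equiv_orC|].
    rewrite !bigor_cons_cons.
    eapply equiv_trans; [apply equiv_orA|].
    eapply equiv_trans; [|apply equiv_sym, equiv_orA].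
    apply equiv_Or; [apply equiv_orC | apply equiv_refl].
  - exact (equiv_trans IH1 IH2).
Qed.

Lemma bigor_map_shift (Sg : signature) (G : sequent Sg) :
  bigor (map (@shift Sg) G) = shift (bigor G).
Proof.
  induction G as [|A [|B G] IH]; [reflexivity | reflexivity |].
  change (Or (shift A) (bigor (map (@shift Sg) (B :: G))) =
          Or (shift A) (shift (bigor (B :: G)))).
  now rewrite IH.
Qed.

Lemma derives_bigor_head (Sg : signature) (A B : formula Sg) G :
  derives A B -> derives (bigor (A :: G)) (bigor (B :: G)).
Proof.
  intros H. destruct G as [|C G]; [exact H|].
  rewrite !bigor_cons_cons. apply derives_Or; [exact H|].
  apply rt_refl.
Qed.

Lemma derives_bigor_wk (Sg : signature) (A : formula Sg) G :
  G <> [] -> derives (bigor G) (bigor (A :: G)).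
Proof.
  intros HG. rewrite (bigor_cons A HG).
  eapply derives_trans; [apply derives_rule, KS1_w|].
  apply derives_equiv, equiv_orC.
Qed.

Lemma bigor_merge (Sg : signature) (A B : formula Sg) G :
  equiv (bigor (A :: B :: G)) (bigor (Or A B :: G)).
Proof.
  destruct G as [|C G]; [apply equiv_refl|].
  rewrite !bigor_cons_cons. apply equiv_orA.
Qed.

(** Two switches, the first extracting [D] and the second [B]. *)
Lemma derives_switch (Sg : signature) (A B C D : formula Sg) :
  derives (And (Or A B) (Or C D)) (Or (And A C) (Or B D)).
Proof.
  apply derives_trans with (Or (And (Or A B) C) D).
  { apply derives_rule, KS1_s. }
  apply derives_trans with (Or (Or (And A C) B) D).
  2: { apply derives_equiv, equiv_sym, equiv_orA. }
  apply derives_Or; [|apply rt_refl].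
  apply derives_trans with (And C (Or A B)).
  { apply derives_equiv, equiv_andC. }
  apply derives_trans with (Or (And C A) B).
  { apply derives_rule, KS1_s. }
  apply derives_equiv, equiv_Or; [apply equiv_andC | apply equiv_refl].
Qed.

(** One switch is used for each nonempty side context, since an empty one contributes no
    disjunct. *)
Lemma derives_bigor_and (Sg : signature) (A B : formula Sg) G D :
  derives (And (bigor (A :: G)) (bigor (B :: D))) (bigor (And A B :: G ++ D)).
Proof.
  destruct G as [|A' G].
  - destruct D as [|B' D]; [apply rt_refl|].
    change ([] ++ B' :: D) with (B' :: D).
    rewrite !bigor_cons_cons. apply derives_rule, KS1_s.
  - destruct D as [|B' D].
    + rewrite app_nil_r, bigor_cons_cons, bigor_cons_cons. simpl (bigor [B]).
      eapply derives_trans; [apply derives_equiv, equiv_andC|].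
      eapply derives_trans; [apply derives_rule, KS1_s|].
      apply derives_equiv, equiv_Or; [apply equiv_andC | apply equiv_refl].
    + rewrite !bigor_cons_cons.
      eapply derives_trans; [apply derives_switch|].
      apply derives_Or; [apply rt_refl|].
      apply derives_equiv, bigor_app; discriminate.
Qed.

(** Two proofs are merged into one linear derivation by running each in its own conjunct of
    [And (At Tt) (At Tt)]. *)
Lemma KS1_And (Sg : signature) (A B : formula Sg) :
  KS1 A -> KS1 B -> KS1 (And A B).
Proof.
  intros HA HB. apply derives_trans with (And (At Tt) (At Tt)).
  - apply derives_rule, KS1_t.
  - now apply derives_And.
Qed.

(** This keeps the default value of [bigor] out of the simulation of weakening, falsity and mix. *)
Lemma LK1_nonempty (Sg : signature) (G : sequent Sg) : LK1 G -> G <> [].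
Proof.
  induction 1 as [G D P _ IH | | | | | | G D _ IH _ _ | | | |];
    try discriminate.
  - intros ->. now apply Permutation_sym, Permutation_nil in P.
  - now destruct G.
Qed.

Lemma LK1_KS1 (Sg : signature) (G : sequent Sg) : LK1 G -> KS1 (bigor G).
Proof.
  induction 1 as [G D P _ IH | a | G A B _ IH | G D A B _ IHA _ IHB | | G HG IH
                 | G D HG IHG HD IHD | G A t _ IH | G A _ IH | G A _ IH
                 | G A HG IH].
  - eapply derives_trans; [exact IH|]. now apply derives_equiv, bigor_perm.
  - apply derives_rule, KS1_ai.
  - eapply derives_trans; [exact IH|]. apply derives_equiv, bigor_merge.
  - eapply derives_trans; [exact (KS1_And IHA IHB)|].
    apply derives_bigor_and.
  - apply rt_refl.
  - eapply derives_trans; [exact IH|].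
    now apply derives_bigor_wk, LK1_nonempty.
  - eapply derives_trans; [exact (KS1_And IHG IHD)|].
    eapply derives_trans; [apply derives_rule, KS1_mix|].
    apply derives_equiv, bigor_app; now apply LK1_nonempty.
  - eapply derives_trans; [exact IH|].
    apply derives_bigor_head, derives_rule, KS1_ex.
  (* The premise is derived under the quantifier, and the shifted side formulas then leave its scope
     by the congruence. *)
  - eapply derives_trans; [apply derives_rule, KS1_all|].
    eapply derives_trans; [exact (derives_All IH)|].
    destruct G as [|B G]; [apply rt_refl|].
    rewrite bigor_cons, bigor_map_shift by discriminate.
    apply derives_equiv. rewrite bigor_cons_cons.
    apply equiv_all_or.
  - eapply derives_trans; [exact IH|].
    eapply derives_trans; [apply derives_equiv, bigor_merge|].
    apply derives_bigor_head, derives_contraction.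
  - eapply derives_trans; [exact IH|].
    now apply derives_bigor_wk, LK1_nonempty.
Qed.

Theorem theorem7p5 (Sg : signature) (G : sequent Sg) (hG : G <> nil) :
  LK1 G <-> KS1 (bigor G).
Proof.
  split.
  - apply LK1_KS1.
  - intros H. now apply LK1_bigor_inv, KS1_LK1.
Qed.
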